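(* For every $\varepsilon>0$ there is a norm $p_\varepsilon$ on $c_0$ which is $\varepsilon$-equivalent to the given (supremum) norm of $c_0$ and such that the space $\mathfrak{X}_\varepsilon=(c_0,p_\varepsilon)$ satisfies: for every two-dimensional linear subspace $Z$ of $\mathfrak{X}_\varepsilon^*$, the set $Z\cap \operatorname{NA}(\mathfrak{X}_\varepsilon,\mathbb{R})$ is contained in the union of two one-dimensional linear subspaces (that is, $S_Z\cap \operatorname{NA}(\mathfrak{X}_\varepsilon,\mathbb{R})$ contains at most four points). Equivalently, given two linearly independent elements $f,g\in\operatorname{NA}(\mathfrak{X}_\varepsilon,\mathbb{R})$, no element $tf+(1-t)g$ with $0<t<1$ belongs to $\operatorname{NA}(\mathfrak{X}_\varepsilon,\mathbb{R})$.
   Context: All Banach spaces are real. For a Banach space $X$, $X^*$ is its topological dual with the dual norm and $S_X$ is its unit sphere; $S_Z$ denotes the unit sphere of the subspace $Z$ with the inherited norm. A functional $f\in X^*$ is norm-attaining if there is $x\in S_X$ with $|f(x)|=\|f\|$; $\operatorname{NA}(X,\mathbb{R})$ denotes the set of norm-attaining functionals on $X$. A norm $p$ on a Banach space $(X,\|\cdot\|)$ is $\varepsilon$-equivalent to $\|\cdot\|$ if there are constants $M,m>0$ with $M/m\leq 1+\varepsilon$ such that $m\|x\|\leq p(x)\leq M\|x\|$ for all $x\in X$. *)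

(* Defs.v *)
From HB Require Import structures.
From mathcomp Require Import all_boot all_order all_algebra.
From mathcomp Require Import all_classical all_reals all_analysis.

Set Implicit Arguments.
Unset Strict Implicit.
Unset Printing Implicit Defensive.

Import Order.TTheory GRing.Theory Num.Theory.
Import numFieldNormedType.Exports.

Local Open Scope classical_set_scope.
Local Open Scope ring_scope.

Section Subspaces.
Context {R : realType} {V : lmodType R}.

Definition lin_indep (n : nat) (e : n.-tuple V) : Prop :=
  forall a : 'I_n -> R, \sum_(i < n) a i *: tnth e i = 0 -> forall i, a i = 0.

Definition lin_span (n : nat) (e : n.-tuple V) : set V :=
  [set v | exists a : 'I_n -> R, v = \sum_(i < n) a i *: tnth e i].

(* A set with an n-element basis is automatically a linear subspace. *)
Definition subspace_of_dim (n : nat) (Z : set V) : Prop :=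
  exists2 e : n.-tuple V, lin_indep e & Z = lin_span e.

End Subspaces.

(* Not to be confused with the canonical norm `|x| of a normedModType: here the
   norm is a value, so that it can be quantified over. *)
Record norm_on (R : realType) (V : lmodType R) := NormOn {
  norm_fun :> V -> R ;
  norm_onD : forall x y, norm_fun (x + y) <= norm_fun x + norm_fun y ;
  norm_onZ : forall (a : R) x, norm_fun (a *: x) = `|a| * norm_fun x ;
  norm_on0_eq0 : forall x, norm_fun x = 0 -> x = 0 }.

Definition eps_equivalent (R : realType) (X : normedModType R) (eps : R)
    (p : norm_on X) : Prop :=
  exists M m : R, [/\ 0 < M, 0 < m, M / m <= 1 + eps
    & forall x : X, m * `|x| <= p x <= M * `|x|].

(* The normed space (V, p): a copy of V on which `|x| denotes p x. *)
Definition renormed (R : realType) (V : lmodType R) (p : norm_on V) : Type := V.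

Section Renormed.
Context {R : realType} (V : lmodType R) (p : norm_on V).
HB.instance Definition _ := GRing.Lmodule.copy (renormed p) V.
HB.instance Definition _ := @Lmodule_isNormed.Build R (renormed p)
  p (norm_onD p) (norm_onZ p) (@norm_on0_eq0 _ _ p).
End Renormed.

Lemma renormed_normE (R : realType) (V : lmodType R) (p : norm_on V)
  (x : renormed p) : `|x| = p x.
Proof. by []. Qed.

Section Dual.
Context {R : realType} (X : normedModType R).

Definition dual_pred : {pred X -> R^o} :=
  fun f => `[< linear f /\ continuous f >].

Lemma dual_pred_submod_closed : submod_closed dual_pred.
Proof.
split=> [|a f g]; rewrite !unfold_in.
  apply/asboolP; split; first by move=> b x y; rewrite /= scaler0 addr0.
  by move=> x; exact: cvg_cst.
move=> /asboolP[lf cf] /asboolP[lg cg]; apply/asboolP; split.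
  move=> b x y.
  rewrite -[LHS]/(a *: f (b *: x + y) + g (b *: x + y)).
  rewrite -[RHS]/(b *: (a *: f x + g x) + (a *: f y + g y)).
  by rewrite lf lg !scalerDr !scalerA [b * a]mulrC addrACA.
move=> x.
by apply: (@cvgD _ _ _ _ _ (fun x => a *: f x) g); [apply: cvgZr|]; [exact: cf|exact: cg].
Qed.

HB.instance Definition _ :=
  GRing.isSubmodClosed.Build R (X -> R^o) dual_pred dual_pred_submod_closed.

Record dual := Dual { dual_fun :> X -> R^o ; dualP : dual_fun \in dual_pred }.

HB.instance Definition _ := [isSub for dual_fun].
HB.instance Definition _ := [Choice of dual by <:].
HB.instance Definition _ := [SubChoice_isSubLmodule of dual by <:].

Lemma dual_linear (f : dual) : linear f.
Proof. by case: f => f /= /asboolP[]. Qed.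

HB.instance Definition _ (f : dual) :=
  GRing.isLinear.Build R X R^o *:%R f (dual_linear f).

Lemma dual_continuous (f : dual) : continuous f.
Proof. by case: f => f /= /asboolP[]. Qed.

Definition dual_norm (f : dual) : R :=
  sup [set `|f x| | x in [set x : X | `|x| <= 1]].

Lemma dual_norm_has_sup (f : dual) :
  has_sup [set `|f x| | x in [set x : X | `|x| <= 1]].
Proof.
split; first by exists `|f 0|; exists 0 => //=; rewrite normr0.
have /linear_bounded_continuous/bounded_funP/(_ 1)[M fM] := @dual_continuous f.
by exists M => _ [x x1 <-]; exact: fM.
Qed.

Lemma dual_norm_ub (f : dual) x : `|x| <= 1 -> `|f x| <= dual_norm f.
Proof.
by move=> x1; apply: (sup_upper_bound (dual_norm_has_sup f)); exists x.
Qed.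

Lemma dual_norm_le (f : dual) M :
  (forall x, `|x| <= 1 -> `|f x| <= M) -> dual_norm f <= M.
Proof.
move=> fM; apply: ge_sup; first by case: (dual_norm_has_sup f).
by move=> _ [x x1 <-]; exact: fM.
Qed.

Lemma dual_normD f g : dual_norm (f + g) <= dual_norm f + dual_norm g.
Proof.
apply: dual_norm_le => x x1; rewrite (le_trans (ler_normD _ _))//.
by rewrite lerD// dual_norm_ub.
Qed.

Lemma dual_normZ (a : R) f : dual_norm (a *: f) = `|a| * dual_norm f.
Proof.
have le b g : dual_norm (b *: g) <= `|b| * dual_norm g.
  apply: dual_norm_le => x x1.
  by rewrite (normrZ b (g x)) ler_wpM2l// dual_norm_ub.
apply/eqP; rewrite eq_le le/=.
have [->|a0] := eqVneq a 0.
  rewrite normr0 mul0r.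
  by apply: (le_trans (normr_ge0 ((0 *: f : dual) 0))); apply: dual_norm_ub; rewrite normr0.
rewrite -ler_pdivlMl ?normr_gt0// -normfV.
by apply: le_trans (le _ _); rewrite scalerA mulVf// scale1r.
Qed.

Lemma dual_norm0_eq0 f : dual_norm f = 0 -> f = 0.
Proof.
move=> f0; apply: val_inj; apply/funext => x.
have [->|x0] := eqVneq x 0; first exact: (linear0 f).
have nx : `|x| != 0 by rewrite normr_eq0.
have : `|f (`|x|^-1 *: x)| <= 0.
  by rewrite -f0 dual_norm_ub// normrZ normfV normr_id mulVf.
rewrite normr_le0 linearZ scaler_eq0 invr_eq0 (negbTE nx)/=.
by move/eqP.
Qed.

HB.instance Definition _ := @Lmodule_isNormed.Build R dual
  dual_norm dual_normD dual_normZ dual_norm0_eq0.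

Lemma dual_normE (f : dual) :
  `|f| = sup [set `|f x| | x in [set x : X | `|x| <= 1]].
Proof. by []. Qed.

End Dual.

Definition unit_sphere (R : realType) (X : normedModType R) : set X :=
  [set x | `|x| = 1].
Arguments unit_sphere {R} X.

Definition NA (R : realType) (X : normedModType R) : set (dual X) :=
  [set f : dual X | exists2 x : X, unit_sphere X x & `|f x| = `|f|].
Arguments NA {R} X.

Section C0.
Context (R : realType).

Definition c0_pred : {pred nat -> R^o} :=
  fun u => `[< u n @[n --> \oo] --> (0 : R^o) >].

Lemma c0_pred_submod_closed : submod_closed c0_pred.
Proof.
split=> [|a u v]; rewrite !unfold_in; first by apply/asboolP; exact: cvg_cst.
move=> /asboolP cu /asboolP cv; apply/asboolP.
have -> : (0 : R^o) = a *: (0 : R^o) + 0 by rewrite scaler0 addr0.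
by apply: (@cvgD _ _ _ _ _ (fun n => a *: u n) v) => //; exact: cvgZr.
Qed.

HB.instance Definition _ :=
  GRing.isSubmodClosed.Build R (nat -> R^o) c0_pred c0_pred_submod_closed.

Record c0 := C0 { c0_seq :> nat -> R^o ; c0P : c0_seq \in c0_pred }.

HB.instance Definition _ := [isSub for c0_seq].
HB.instance Definition _ := [Choice of c0 by <:].
HB.instance Definition _ := [SubChoice_isSubLmodule of c0 by <:].

Lemma c0_cvg (u : c0) : u n @[n --> \oo] --> (0 : R^o).
Proof. by case: u => u /= /asboolP. Qed.

Definition c0_norm (u : c0) : R := sup (range (fun n => `|u n|)).

Lemma c0_norm_has_sup (u : c0) : has_sup (range (fun n => `|u n|)).
Proof.
split; first by exists `|u 0%N|; exists 0%N.
have /cvg_seq_bounded : cvgn (u : nat -> R^o).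
  by apply: (cvgP (0 : R^o)); exact: c0_cvg.
move=> [M [_ uM]]; exists (M + 1) => _ [n _ <-].
by apply: uM => //; rewrite ltrDl.
Qed.

Lemma c0_norm_ub (u : c0) n : `|u n| <= c0_norm u.
Proof. by apply: (sup_upper_bound (c0_norm_has_sup u)); exists n. Qed.

Lemma c0_norm_le (u : c0) M : (forall n, `|u n| <= M) -> c0_norm u <= M.
Proof.
move=> uM; apply: ge_sup; first by case: (c0_norm_has_sup u).
by move=> _ [n _ <-].
Qed.

Lemma c0_normD u v : c0_norm (u + v) <= c0_norm u + c0_norm v.
Proof.
apply: c0_norm_le => n; rewrite (le_trans (ler_normD _ _))//.
by rewrite lerD// c0_norm_ub.
Qed.

Lemma c0_normZ (a : R) u : c0_norm (a *: u) = `|a| * c0_norm u.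
Proof.
have le b v : c0_norm (b *: v) <= `|b| * c0_norm v.
  by apply: c0_norm_le => n; rewrite (normrZ b (v n)) ler_wpM2l// c0_norm_ub.
apply/eqP; rewrite eq_le le/=.
have [->|a0] := eqVneq a 0.
  rewrite normr0 mul0r.
  exact: (le_trans (normr_ge0 ((0 *: u : c0) 0%N))) (c0_norm_ub _ _).
rewrite -ler_pdivlMl ?normr_gt0// -normfV.
by apply: le_trans (le _ _); rewrite scalerA mulVf// scale1r.
Qed.

Lemma c0_norm0_eq0 u : c0_norm u = 0 -> u = 0.
Proof.
move=> u0; apply: val_inj; apply/funext => n; apply/eqP.
by rewrite -normr_le0 -u0 c0_norm_ub.
Qed.

HB.instance Definition _ := @Lmodule_isNormed.Build R c0
  c0_norm c0_normD c0_normZ c0_norm0_eq0.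

Lemma c0_normE (u : c0) : `|u| = sup (range (fun n => `|u n|)).
Proof. by []. Qed.

End C0.

(* Main.v *)
Require Import Defs.
From mathcomp Require Import all_boot all_order all_algebra.
From mathcomp Require Import all_classical all_reals all_analysis.
From mathcomp Require Import zify ring lra.
Import Order.TTheory GRing.Theory Num.Theory.
Import numFieldNormedType.Exports.
Local Open Scope classical_set_scope.
Local Open Scope card_scope.
Local Open Scope ring_scope.

(* The unit ball of the new norm is {Psi <= 1}, where Psi is convex, even and
   Gateaux differentiable, so a functional attaining its norm at x is a
   multiple of the derivative of Psi at x.  Psi is the sum of a part depending
   locally on finitely many coordinates, whose derivative is finitely
   supported, and of a weighted series of Huber functions of functionals w_n
   that are dense in the finitely supported ones and almost independent modulo
   finitely supported sequences.  If f, g and a f + b g attain their norms at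
   x, y and z, the slopes of the n-th Huber function at w_n(x), w_n(y), w_n(z)
   therefore satisfy, asymptotically in n, a fixed relation
   A s(x) + B s(y) = C s(z), with A and B nonzero multiples of a and b.  These
   slopes tend to signs: A sgn v(x) + B sgn v(y) = C sgn v(z) for every finitely
   supported v not vanishing at x, y and z.  When x and y are independent, v can
   be chosen with equal or with opposite signs at x and y, so
   |A + B| = |C| = |A - B| and A B = 0; when they are dependent, f and g are
   multiples of the same derivative. *)

(** * Clamping to [-1, 1], the Huber function and the squared excess *)

Section Clamp.
Context {R : realType}.
Implicit Types a b t : R.

Definition clamp t := Num.max (-1) (Num.min 1 t).

Variant clamp_spec t : R -> Type :=
| ClampLow of t <= -1 : clamp_spec t (-1)
| ClampMid of -1 <= t & t <= 1 : clamp_spec t t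
| ClampHigh of 1 <= t : clamp_spec t 1.

Lemma clampP t : clamp_spec t (clamp t).
Proof.
have N11 : -1 <= 1 :> R by lra.
rewrite /clamp; case: (leP 1 t) => h1.
  by rewrite (max_idPr _)//; constructor.
by case: (leP t (-1)) => h2; constructor=> //; apply/ltW.
Qed.

(** This is t^2/2 on [-1, 1] and |t| - 1/2 outside; its derivative is [clamp]. *)
Definition huber t := t * clamp t - clamp t ^+ 2 / 2.

(** Squared distance to [-1, 1], with derivative 2 (t - [clamp] t). *)
Definition excess t := (t - clamp t) ^+ 2.

(** The lower bound is convexity; the upper bound holds because the derivative [clamp] is
    1-Lipschitz. *)
Lemma huber_grad a b :
  0 <= huber b - huber a - clamp a * (b - a) <= (b - a) ^+ 2 / 2.
Proof.
have sq := sqr_ge0 (b - a).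
rewrite /huber; case: clampP => [hb|hb hb'|hb]; case: clampP => [ha|ha ha'|ha];
  apply/andP; split; nra.
Qed.

Lemma excess_grad a b :
  0 <= excess b - excess a - 2 * (a - clamp a) * (b - a) <= (b - a) ^+ 2.
Proof.
have sq := sqr_ge0 (b - a).
rewrite /excess; case: clampP => [hb|hb hb'|hb]; case: clampP => [ha|ha ha'|ha];
  apply/andP; split; nra.
Qed.

Lemma clampN t : clamp (- t) = - clamp t.
Proof. by case: clampP => [h|h h'|h]; case: clampP => [i|i i'|i]; lra. Qed.

Lemma clamp_le1 t : `|clamp t| <= 1.
Proof. by rewrite ler_norml; case: clampP => [h|h h'|h]; lra. Qed.

Lemma clamp_id t : `|t| <= 1 -> clamp t = t.
Proof.
by rewrite ler_norml => /andP[ht ht']; case: clampP => [h|h h'|h]; lra.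
Qed.

Lemma clamp_lipschitz a b : `|clamp a - clamp b| <= `|a - b|.
Proof.
rewrite ler_norml; have [h|h] := ger0P (a - b);
  by case: clampP => [i|i i1|i]; case: clampP => [j|j j1|j]; lra.
Qed.

Lemma clamp_sgr t : 1 <= `|t| -> clamp t = Num.sg t.
Proof.
case: (ltrgtP 0 t) => [t0|t0|<-]; last by rewrite normr0 => h; lra.
- by rewrite gtr0_norm// gtr0_sg// => t1; case: clampP => [h|h h'|h]; lra.
- by rewrite ltr0_norm// ltr0_sg// => t1; case: clampP => [h|h h'|h]; lra.
Qed.

Lemma huberN t : huber (- t) = huber t.
Proof. by rewrite /huber clampN; lra. Qed.

Lemma excessN t : excess (- t) = excess t.
Proof. by rewrite /excess clampN; ring. Qed.

Lemma huber_ge0 t : 0 <= huber t.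
Proof. by rewrite /huber; case: clampP => [h|h h'|h]; nra. Qed.

Lemma huber_le_norm t : huber t <= `|t|.
Proof.
by rewrite /huber; have [i|i] := ger0P t; case: clampP => [h|h h'|h]; nra.
Qed.

Lemma excess_ge0 t : 0 <= excess t.
Proof. exact: sqr_ge0. Qed.

Lemma excess_eq0 t : `|t| <= 1 -> excess t = 0.
Proof. by move=> h; rewrite /excess clamp_id// subrr expr0n. Qed.

Lemma norm_le_excess t (e : R) : 0 < e -> excess t <= e ^+ 2 -> `|t| <= 1 + e.
Proof.
move=> e0; rewrite /excess => h.
suff : `|t - clamp t| <= e.
  by rewrite !ler_norml; case: clampP h => [j|j j'|j] _; lra.
by rewrite -(ler_pXn2r (n := 2)) ?nnegrE ?(ltW e0)// real_normK ?num_real.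
Qed.
End Clamp.

(** * Series dominated by a geometric series *)

Section Gsum.
Context {R : realType}.
Implicit Types u v : nat -> R.

(** One summability condition that is stable under linear combinations and covers both finitely
    supported terms and the weighted Huber terms. *)
Definition geom_bounded u := exists C : R, forall n, `|u n| <= C / 2 ^+ n.

Lemma geom_boundedD u v : geom_bounded u -> geom_bounded v ->
  geom_bounded (fun n => u n + v n).
Proof.
move=> [C uC] [D vD]; exists (C + D) => n; rewrite mulrDl.
by rewrite (le_trans (ler_normD _ _))// lerD.
Qed.

Lemma geom_boundedZ u (a : R) : geom_bounded u ->
  geom_bounded (fun n => a * u n).
Proof.
move=> [C uC]; exists (`|a| * C) => n.
by rewrite normrM -mulrA ler_wpM2l.
Qed.

Lemma geom_bounded_finite u N : (forall n, (N <= n)%N -> u n = 0) ->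
  geom_bounded u.
Proof.
move=> u0; exists (\sum_(i < N) `|u i| * 2 ^+ i) => n.
rewrite ler_pdivlMr ?exprn_gt0//.
have [Nn|nN] := leqP N n.
  by rewrite u0// normr0 mul0r sumr_ge0// => i _; rewrite mulr_ge0 ?exprn_ge0.
by rewrite (bigD1 (Ordinal nN))//= lerDl sumr_ge0.
Qed.

Let half_lt1 : `|2^-1 : R| < 1.
Proof. by rewrite ger0_norm ?invr_ge0// invf_lt1 ?ltr1n. Qed.

Lemma cvg_div_pow2 (C : R) : C / 2 ^+ n @[n --> \oo] --> (0 : R).
Proof.
have := cvg_geometric C half_lt1; rewrite /geometric/=.
by under eq_cvg do rewrite exprVn.
Qed.

Lemma cvg_series_pow2 : series (fun n => (2 ^+ n)^-1 : R) @ \oo --> (2 : R).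
Proof.
have -> : (fun n => (2 ^+ n)^-1 : R) = geometric 1 2^-1.
  by apply/funext => n; rewrite /= mul1r exprVn.
have := @cvg_geometric_series R 1 _ half_lt1.
by rewrite (_ : 1 / (1 - 2^-1) = 2)//; field.
Qed.

Lemma geom_bounded_cvg u : geom_bounded u -> cvgn (series u).
Proof.
move=> [C uC]; apply: normed_cvg.
apply: (@series_le_cvg _ _ (fun n => C / 2 ^+ n)) => [n|n|n|].
- exact: normr_ge0.
- exact: le_trans (uC n).
- exact: uC.
rewrite (_ : series _ = cst C \* series (fun n => (2 ^+ n)^-1 : R)).
  by apply: is_cvgM; [exact: is_cvg_cst|exact: cvgP cvg_series_pow2].
by apply/funext => n; rewrite /series/= mulr_sumr.
Qed.

Definition gsum u : R := limn (series u).

Lemma gsumD u v : geom_bounded u -> geom_bounded v ->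
  gsum (fun n => u n + v n) = gsum u + gsum v.
Proof.
move=> /geom_bounded_cvg cu /geom_bounded_cvg cv; rewrite /gsum.
rewrite (_ : series (fun n => _) = series u \+ series v); first exact: limD.
by apply/funext => n; rewrite /series/= big_split.
Qed.

Lemma gsumZ u (a : R) : geom_bounded u ->
  gsum (fun n => a * u n) = a * gsum u.
Proof.
move=> /geom_bounded_cvg cu; rewrite /gsum.
rewrite (_ : series (fun n => _) = cst a \* series u).
  by apply: cvg_lim => //; apply: cvgM => //; exact: cvg_cst.
by apply/funext => n; rewrite /series/= mulr_sumr.
Qed.

Lemma gsum_ge0 u : geom_bounded u -> (forall n, 0 <= u n) -> 0 <= gsum u.
Proof.
move=> /geom_bounded_cvg cu u0; apply: limr_ge => //.
by apply: nearW => n; rewrite /series/= sumr_ge0.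
Qed.

Lemma gsumB u v : geom_bounded u -> geom_bounded v ->
  gsum (fun n => u n - v n) = gsum u - gsum v.
Proof.
move=> bu bv; have bv' := geom_boundedZ v (-1) bv.
rewrite -[gsum u - _]addrC -mulN1r -(gsumZ v)// addrC -gsumD//.
by congr gsum; apply/funext => n; rewrite mulN1r.
Qed.

Lemma geom_boundedB u v : geom_bounded u -> geom_bounded v ->
  geom_bounded (fun n => u n - v n).
Proof.
move=> bu bv; have bv' := geom_boundedZ v (-1) bv.
have := geom_boundedD u _ bu bv'.
by congr geom_bounded; apply/funext => n; rewrite mulN1r.
Qed.

Lemma gsum_le u v : geom_bounded u -> geom_bounded v ->
  (forall n, u n <= v n) -> gsum u <= gsum v.
Proof.
move=> bu bv uv; rewrite -subr_ge0 -gsumB//; apply: gsum_ge0.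
  exact: geom_boundedB.
by move=> n; rewrite subr_ge0.
Qed.

Lemma gsum_abs_le u (C : R) : (forall n, `|u n| <= C / 2 ^+ n) ->
  `|gsum u| <= 2 * C.
Proof.
move=> uC.
have bg : geom_bounded (fun n => (2 ^+ n)^-1 : R).
  by exists 1 => n; rewrite mul1r ger0_norm// invr_ge0 exprn_ge0.
have bu : geom_bounded u by exists C.
have gC a : gsum (fun n => a * (2 ^+ n)^-1) = 2 * a.
  by rewrite gsumZ// mulrC /gsum; congr (_ * _); apply: cvg_lim cvg_series_pow2.
rewrite ler_norml -mulrN -(gC C) -(gC (- C)); apply/andP.
split; apply: gsum_le => //; try exact: geom_boundedZ.
  by move=> n; have := uC n; rewrite mulNr ler_norml => /andP[].
by move=> n; have := uC n; rewrite ler_norml => /andP[].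
Qed.

Lemma gsum_single u m : (forall n, n != m -> u n = 0) -> gsum u = u m.
Proof.
move=> u0; apply: cvg_lim => //; apply: cvg_near_cst; near=> n.
have mn : (m < n)%N by near: n; exists m.+1.
rewrite /series/= (bigD1_seq m) ?mem_index_iota ?iota_uniq//= big1 ?addr0//.
Unshelve. all: by end_near. Qed.
End Gsum.

(** * The Minkowski gauge of a sublevel set of a convex, even, Gateaux differentiable function *)

Section Gauge.
Context {R : realType} {V : normedModType R}.
Variables (Psi : V -> R) (D : V -> V -> R) (M : R).
Hypothesis Dlin : forall x a h k, D x (a *: h + k) = a * D x h + D x k.
Hypothesis Psi_grad : forall x y, Psi x + D x (y - x) <= Psi y.
(** Together with [Psi_grad], this makes [D x] the Gateaux derivative at x. The constant may depend
    on x and h: no uniform smoothness is assumed. *)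
Hypothesis Psi_upper : forall x h, exists C, forall t, 0 <= t <= 1 ->
  Psi (x + t *: h) <= Psi x + t * D x h + C * t ^+ 2.
Hypothesis PsiN : forall x, Psi (- x) = Psi x.
Hypothesis Psi0 : Psi 0 = 0.
Hypothesis Psi_unit_ball : forall x, `|x| <= 1 -> Psi x <= 1.
Hypothesis M_gt0 : 0 < M.
Hypothesis Psi_bounded : forall x, Psi x <= 1 -> `|x| <= M.

Let D0 x : D x 0 = 0.
Proof. by have := Dlin x 1 0 0; rewrite scale1r addr0; lra. Qed.

Let DZ x a h : D x (a *: h) = a * D x h.
Proof. by rewrite -[a *: h]addr0 Dlin D0 addr0. Qed.

Let DD x h k : D x (h + k) = D x h + D x k.
Proof. by rewrite -{1}[h]scale1r Dlin mul1r. Qed.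

Let DN x h : D x (- h) = - D x h.
Proof. by rewrite -scaleN1r DZ mulN1r. Qed.

(** Add the subgradient inequalities at the intermediate point z towards both ends; the weighted
    linear terms cancel. *)
Let Psi_convex x y (s : R) : 0 <= s <= 1 ->
  Psi (s *: x + (1 - s) *: y) <= s * Psi x + (1 - s) * Psi y.
Proof.
move=> s01; set z := s *: x + _.
have hx := Psi_grad z x; have hy := Psi_grad z y.
have : s * D z (x - z) + (1 - s) * D z (y - z) = 0.
  rewrite -!DZ -DD !scalerBr addrACA -opprD -scalerDl [s + _]addrC.
  by rewrite subrK scale1r subrr D0.
by nra.
Qed.

Definition gauge_set x : set R := [set l | 0 < l /\ Psi (l^-1 *: x) <= 1].

Definition sublevel_gauge x : R := inf (gauge_set x).

Let p := sublevel_gauge.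

Let gauge_norm x l : 0 < l -> `|x| <= l -> gauge_set x l.
Proof.
move=> l0 xl; split=> //; apply: Psi_unit_ball.
by rewrite normrZ gtr0_norm ?invr_gt0// mulrC ler_pdivrMr// mul1r.
Qed.

Let has_inf_gauge_set x : has_inf (gauge_set x).
Proof.
split; last by exists 0 => l [/ltW].
exists (`|x| + 1); apply: gauge_norm; last by rewrite lerDl.
by rewrite ltr_wpDl.
Qed.

Let gauge_le x l : gauge_set x l -> p x <= l.
Proof. by move=> h; apply: ge_inf => //; case: (has_inf_gauge_set x). Qed.

Let le_gauge x c : (forall l, gauge_set x l -> c <= l) -> c <= p x.
Proof. by move=> h; apply: lb_le_inf => //; case: (has_inf_gauge_set x). Qed.

Lemma gauge_le_norm x : p x <= `|x|.
Proof.
apply/ler_addgt0Pr => e e0; apply: gauge_le; apply: gauge_norm.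
  by rewrite ltr_wpDl.
by rewrite lerDl ltW.
Qed.

Lemma norm_le_gauge x : M^-1 * `|x| <= p x.
Proof.
apply: le_gauge => l [l0 /Psi_bounded].
by rewrite normrZ gtr0_norm ?invr_gt0// ler_pdivrMl// ler_pdivrMl// mulrC.
Qed.

Lemma gaugeD x y : p (x + y) <= p x + p y.
Proof.
rewrite -lerBlDr; apply: le_gauge => l [l0 hl].
rewrite lerBlDr -lerBlDl; apply: le_gauge => m [m0 hm].
rewrite lerBlDl; apply: gauge_le; have lm0 : 0 < l + m by rewrite addr_gt0.
split=> //.
(* The rescaled sum is a convex combination of two points of the sublevel set. *)
have -> : (l + m)^-1 *: (x + y) =
    (l / (l + m)) *: (l^-1 *: x) + (1 - l / (l + m)) *: (m^-1 *: y).
  rewrite !scalerA scalerDr; congr (_ *: _ + _ *: _); field.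
    by rewrite !gt_eqF.
  by rewrite !gt_eqF.
have h01 : 0 <= l / (l + m) <= 1.
  rewrite divr_ge0 ?(ltW l0) ?(ltW lm0)//=.
  by rewrite ler_pdivrMr// mul1r lerDl ltW.
by apply: (le_trans (Psi_convex _ _ _ h01)); nra.
Qed.

Lemma gaugeZ a x : p (a *: x) = `|a| * p x.
Proof.
have p0 : p 0 = 0.
  apply/eqP; rewrite eq_le (le_trans (gauge_le_norm _)) ?normr0//=.
  by apply: le_gauge => l [/ltW].
(* This inequality, applied also to the inverse scalar, gives equality. *)
have le b y : b != 0 -> p (b *: y) <= `|b| * p y.
  move=> b0; have nb : 0 < `|b| by rewrite normr_gt0.
  rewrite -ler_pdivrMl//; apply: le_gauge => l [l0 hl].
  rewrite ler_pdivrMl//; apply: gauge_le; split; first by rewrite mulr_gt0.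
  rewrite scalerA; case: (ger0P b) nb => hb nb.
    rewrite (_ : (b * l)^-1 * b = l^-1)//; field.
    by rewrite !gt_eqF.
  rewrite (_ : (- b * l)^-1 * b = - l^-1) ?scaleNr ?PsiN//; field.
  by rewrite ?oppr_eq0 ?b0 ?(gt_eqF l0).
have [->|a0] := eqVneq a 0; first by rewrite scale0r normr0 mul0r.
apply/eqP; rewrite eq_le le//=.
rewrite -ler_pdivlMl ?normr_gt0// -normfV.
by apply: le_trans (le _ _ _); rewrite ?invr_eq0// scalerA mulVf// scale1r.
Qed.

Lemma gauge0_eq0 x : p x = 0 -> x = 0.
Proof.
move=> px; apply/eqP; rewrite -normr_le0 -(@ler_pM2l _ M^-1) ?invr_gt0//.
by rewrite mulr0 -px norm_le_gauge.
Qed.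

Definition gauge_norm_on : norm_on V := NormOn gaugeD gaugeZ gauge0_eq0.

Let Psi_le1 x : p x = 1 -> Psi x <= 1.
Proof.
move=> px; apply/ler_addgt0Pr => e e0.
(* The infimum may not be attained, so take l within d of 1. The subgradient inequality along the
   ray through x loses at most d |D x x| <= e. *)
set d := e / (1 + `|D x x|).
have d0 : 0 < d by rewrite divr_gt0// ltr_wpDr.
have [l [l0 hl] lt] := inf_adherent d0 (has_inf_gauge_set x).
rewrite -/(sublevel_gauge x) -/p px in lt.
have l1 : 1 <= l by rewrite -px; apply: gauge_le.
have := Psi_grad x (l^-1 *: x).
have -> : l^-1 *: x - x = (l^-1 - 1) *: x by rewrite scalerBl scale1r.
rewrite DZ => h.
have h1 : `|(l^-1 - 1) * D x x| <= e.
  rewrite normrM.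
  have h2 : `|l^-1 - 1| <= d.
    rewrite ler0_norm ?subr_le0 ?invf_le1// opprB.
    have li : l^-1 * l = 1 by rewrite mulVf// gt_eqF.
    have li0 : 0 < l^-1 by rewrite invr_gt0.
    nra.
  apply: (le_trans (ler_wpM2r (normr_ge0 _) h2)).
  rewrite /d mulrAC ler_pdivrMr ?ltr_wpDr//.
  by rewrite ler_wpM2l ?(ltW e0)// lerDr.
by move: h1; rewrite ler_norml => /andP[h1 _]; lra.
Qed.

(** If D x x <= 0, comparison with 0 gives Psi x <= 0, so [Psi_upper] leaves room to stretch x by a
    factor 1 + t inside the sublevel set, against p x = 1. *)
Let D_gt0 x : p x = 1 -> 0 < D x x.
Proof.
move=> px; rewrite ltNge; apply/negP => Dx.
have Psix : Psi x <= 0.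
  by have := Psi_grad x 0; rewrite Psi0 sub0r DN; lra.
have [C hC] := Psi_upper x x.
pose t := (1 + `|C|)^-1.
have c0 : 0 < 1 + `|C| by rewrite ltr_wpDr.
have t0 : 0 < t by rewrite invr_gt0.
have t1 : t <= 1 by rewrite invf_le1// lerDl.
have tc : t * (1 + `|C|) = 1 by rewrite mulVf// gt_eqF.
have Cle := ler_norm C.
have h : Psi ((1 + t) *: x) <= 1.
  rewrite scalerDl scale1r (le_trans (hC _ _))//; first by rewrite (ltW t0).
  nra.
have : p x <= (1 + t)^-1.
  apply: gauge_le; split; last by rewrite invrK.
  by rewrite invr_gt0 addr_gt0.
rewrite px invf_ge1 ?addr_gt0//; lra.
Qed.

(* Lagrange multipliers for the constraint Psi <= 1: no descent direction of Psi
   at x is an ascent direction of f. *)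
Lemma support_proportional (f : V -> R) x :
    (forall a h k, f (a *: h + k) = a * f h + f k) ->
    p x = 1 -> (forall u, p u <= 1 -> f u <= f x) ->
  exists mu, forall h, f h = mu * D x h.
Proof.
move=> flin px fmax.
have f0 : f 0 = 0 by have := flin 1 0 0; rewrite scale1r addr0; lra.
have fZ a h : f (a *: h) = a * f h by rewrite -[a *: h]addr0 flin f0 addr0.
have fD h k : f (h + k) = f h + f k by rewrite -{1}[h]scale1r flin mul1r.
have fN h : f (- h) = - f h by rewrite -scaleN1r fZ mulN1r.
have Dx := D_gt0 _ px; have Px := Psi_le1 _ px.
have desc h : D x h < 0 -> f h <= 0.
  move=> Dh; have [C hC] := Psi_upper x h.
  pose s := (1 + `|C|)^-1.
  have c0 : 0 < 1 + `|C| by rewrite ltr_wpDr.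
  have s0 : 0 < s by rewrite invr_gt0.
  have s1 : s <= 1 by rewrite invf_le1// lerDl.
  have sc : s * (1 + `|C|) = 1 by rewrite mulVf// gt_eqF.
  have Cs : C * s <= 1 by have := ler_norm C; nra.
  (* Here r <= 1 and r <= - D x h, while s absorbs C: the quadratic term is at most s r r, which the
     linear gain s r (- D x h) outweighs. *)
  pose r := - D x h / (1 - D x h).
  have d0 : 0 < 1 - D x h by lra.
  have rd : r * (1 - D x h) = - D x h by rewrite divfK// gt_eqF.
  have r0 : 0 < r by rewrite divr_gt0// oppr_gt0.
  have r1 : r <= 1 by rewrite ler_pdivrMr//; lra.
  have h1 : Psi (x + (s * r) *: h) <= 1.
    have t0 : 0 < s * r by rewrite mulr_gt0.
    have t01 : 0 <= s * r <= 1 by rewrite (ltW t0)/=; nra.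
    apply: (le_trans (hC _ t01)).
    have e1 : C * (s * r) ^+ 2 <= s * r * r.
      rewrite (_ : C * (s * r) ^+ 2 = s * r * r * (C * s)); last by ring.
      by rewrite ger_pMr ?(mulr_gt0 t0 r0).
    have e2 : r <= - D x h by nra.
    have e3 : s * r * (D x h + r) <= 0 by rewrite pmulr_rle0//; lra.
    nra.
  have : f (x + (s * r) *: h) <= f x.
    by apply: fmax; apply: gauge_le; split; rewrite // invr1 scale1r.
  by rewrite fD fZ gerDl pmulr_rle0// mulr_gt0.
have fx0 : 0 <= f x.
  by rewrite -f0; apply: fmax; rewrite (le_trans (gauge_le_norm _))// normr0.
(* A kernel direction is a limit of the descent directions h - d x, whence f h <= d f x for every d
   > 0. *)
have ker h : D x h = 0 -> f h <= 0.
  move=> Dh; apply/ler_addgt0Pr => e e0; rewrite add0r.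
  pose d := e / (1 + f x).
  have c0 : 0 < 1 + f x by rewrite ltr_wpDr.
  have d0 : 0 < d by rewrite divr_gt0.
  have dc : d * (1 + f x) = e by rewrite divfK// gt_eqF.
  have := desc (h - d *: x); rewrite DD DN DZ Dh fD fN fZ.
  by rewrite sub0r oppr_lt0 mulr_gt0// => /(_ isT); lra.
(* Applied to both signs, the previous bound makes f vanish on the kernel of [D x]; evaluating at x
   fixes the multiplier. *)
exists (f x / D x x) => h.
pose k := h - (D x h / D x x) *: x.
have Dk : D x k = 0 by rewrite DD DN DZ divfK ?subrr// gt_eqF.
have h1 := ker _ Dk.
have h2 : f (- k) <= 0 by apply: ker; rewrite DN Dk oppr0.
have : f k = 0 by apply/eqP; rewrite eq_le h1 -oppr_le0 -fN.
rewrite fD fN fZ => /eqP; rewrite subr_eq0 => /eqP ->.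
by field; rewrite gt_eqF.
Qed.

End Gauge.

(** * Planes, lines and the points of a line on the unit sphere *)

Section Plane.
Context {R : realType} {W : lmodType R}.
Implicit Types (f g : W) (Z S : set W).

Lemma lin_indep2P f g : lin_indep [tuple f; g] <->
  forall a b : R, a *: f + b *: g = 0 -> a = 0 /\ b = 0.
Proof.
split=> [fg a b ab|fg a].
  have h := fg (fun i => if i == ord0 then a else b).
  rewrite big_ord_recl big_ord1/= in h.
  by split; [exact: (h ab ord0)|exact: (h ab (lift ord0 ord0))].
rewrite big_ord_recl big_ord1 => /fg[a0 a1] i.
by case: (unliftP ord0 i) => [j|] ->; rewrite // (ord1 j).
Qed.

Lemma lin_span2E f g :
  lin_span [tuple f; g] = [set v | exists a b : R, v = a *: f + b *: g].
Proof.
apply/seteqP; split=> [v [a ->]|v [a [b ->]]] /=.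
  by exists (a ord0), (a (lift ord0 ord0)); rewrite big_ord_recl big_ord1.
exists (fun i => if i == ord0 then a else b).
by rewrite big_ord_recl big_ord1.
Qed.

Lemma subspace_of_dim1 f : f != 0 ->
  subspace_of_dim 1 [set v | exists a : R, v = a *: f].
Proof.
move=> f0; exists [tuple f].
  move=> a; rewrite big_ord1 => /eqP.
  by rewrite scaler_eq0 (negbTE f0) orbF => /eqP h i; rewrite (ord1 i).
apply/seteqP; split=> [v [a ->]|v [a ->]].
  by exists (fun=> a); rewrite big_ord1.
by exists (a ord0); rewrite big_ord1.
Qed.

Lemma subspace_of_dim1E Z : subspace_of_dim 1 Z ->
  exists2 f, f != 0 & Z = [set v | exists a : R, v = a *: f].
Proof.
move=> [e ie ->]; exists (tnth e ord0).
  apply/eqP => e0; have := ie (fun=> 1).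
  rewrite big_ord1 e0 scaler0 => /(_ erefl ord0)/eqP.
  by rewrite oner_eq0.
apply/seteqP; split=> [v [a ->]|v [a ->]].
  by exists (a ord0); rewrite big_ord1.
by exists (fun=> a); rewrite big_ord1.
Qed.

Lemma subspace_of_dim2E Z : subspace_of_dim 2 Z ->
  exists f g, lin_indep [tuple f; g] /\
    Z = [set v | exists a b : R, v = a *: f + b *: g].
Proof.
move=> [e ie ->].
have e2 : e = [tuple tnth e ord0; tnth e (lift ord0 ord0)].
  apply: eq_from_tnth => i.
  by case: (unliftP ord0 i) => [j|] ->; rewrite // (ord1 j).
exists (tnth e ord0), (tnth e (lift ord0 ord0)).
by rewrite -lin_span2E -e2.
Qed.

Lemma plane_spanned Z f g : subspace_of_dim 2 Z -> Z f -> Z g ->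
  lin_indep [tuple f; g] ->
  Z `<=` [set v | exists a b : R, v = a *: f + b *: g].
Proof.
move=> /subspace_of_dim2E[e1 [e2 [_ ->]]] [a1 [a2 fE]] [b1 [b2 gE]].
move=> /lin_indep2P fg v [c1 [c2 ->]] /=.
pose d := a1 * b2 - a2 * b1.
have comb s t : s *: f + t *: g =
    (s * a1 + t * b1) *: e1 + (s * a2 + t * b2) *: e2.
  by rewrite fE gE !scalerDr !scalerA !scalerDl addrACA.
(* If the determinant vanishes, (b2, -a2) and (b1, -a1) are relations between f and g, so f = g = 0,
   which contradicts independence. Otherwise Cramer's rule gives the coefficients. *)
have [d0|d0] := eqVneq d 0.
  rewrite /d in d0.
  have zero : forall s t, s * a1 + t * b1 = 0 -> s * a2 + t * b2 = 0 ->
      s = 0 /\ t = 0.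
    by move=> s t h1 h2; apply: fg; rewrite comb h1 h2 !scale0r addr0.
  have [h1 h2] : b2 = 0 /\ - a2 = 0 by apply: zero; lra.
  have [h3 h4] : b1 = 0 /\ - a1 = 0 by apply: zero; lra.
  have [/eqP] : 1 = 0 :> R /\ 0 = 0 :> R by apply: zero; lra.
  by rewrite oner_eq0.
exists ((c1 * b2 - c2 * b1) / d), ((a1 * c2 - a2 * c1) / d).
by rewrite comb; congr (_ *: _ + _ *: _); rewrite /d; field.
Qed.

(** If Z meets S in an independent pair, the lines of that pair suffice. If not, one line suffices:
    that of any nonzero common vector, or an arbitrary line of Z when there is none. *)
Lemma two_lines S Z :
    (forall f g, S f -> S g -> lin_indep [tuple f; g] ->
      forall a b : R, S (a *: f + b *: g) -> a = 0 \/ b = 0) ->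
    subspace_of_dim 2 Z ->
  exists L1 L2, [/\ subspace_of_dim 1 L1, subspace_of_dim 1 L2
    & Z `&` S `<=` L1 `|` L2].
Proof.
move=> hS hZ.
have [[f [g [[Zf Sf] [Zg Sg] fg]]]|nfg] := pselect (exists f g,
    [/\ (Z `&` S) f, (Z `&` S) g & lin_indep [tuple f; g]]).
  have fg' := (lin_indep2P _ _).1 fg.
  have f0 : f != 0.
    apply/eqP => f0; have [] := fg' 1 0.
      by rewrite f0 scaler0 scale0r addr0.
    by move/eqP; rewrite oner_eq0.
  have g0 : g != 0.
    apply/eqP => g0; have [] := fg' 0 1.
      by rewrite g0 scaler0 scale0r addr0.
    by move=> _ /eqP; rewrite oner_eq0.
  exists [set v | exists a : R, v = a *: f], [set v | exists a : R, v = a *: g].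
  split; try exact: subspace_of_dim1.
  move=> v [Zv Sv]; have [a [b vE]] := plane_spanned _ _ _ hZ Zf Zg fg _ Zv.
  rewrite vE in Sv; have [a0|b0] := hS f g Sf Sg fg a b Sv.
    by right; exists b; rewrite vE a0 scale0r add0r.
  by left; exists a; rewrite vE b0 scale0r addr0.
suff [f f0 hf] : exists2 f, f != 0 &
    Z `&` S `<=` [set v | exists a : R, v = a *: f].
  exists [set v | exists a : R, v = a *: f], [set v | exists a : R, v = a *: f].
  by split; [exact: subspace_of_dim1..|move=> v /hf; left].
have [[f f0 ZSf]|nf] := pselect (exists2 f, f != 0 & (Z `&` S) f).
  exists f => // v ZSv; apply: contrapT => nv; apply: nfg; exists f, v.
  split=> //; apply/lin_indep2P => a b ab.
  have b0 : b = 0.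
    apply: contrapT => /eqP b0; apply: nv; exists (- (b^-1 * a)).
    apply: (scalerI b0); rewrite scalerA mulrN mulVKf// scaleNr.
    by apply/eqP; rewrite -addr_eq0 addrC ab.
  split=> //; move: ab; rewrite b0 scale0r addr0 => /eqP.
  by rewrite scaler_eq0 (negbTE f0) orbF => /eqP.
have [e1 [e2 [/lin_indep2P ie _]]] := subspace_of_dim2E _ hZ.
exists e1.
  apply/eqP => e0; have [] := ie 1 0; first by rewrite e0 scaler0 scale0r addr0.
  by move/eqP; rewrite oner_eq0.
move=> v ZSv; exists 0; rewrite scale0r; apply: contrapT => /eqP v0.
by apply: nf; exists v.
Qed.

End Plane.

Lemma card_sphere_two_lines {R : realType} (W : normedModType R)
    (L1 L2 A : set W) :
  subspace_of_dim 1 L1 -> subspace_of_dim 1 L2 ->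
  A `<=` L1 `|` L2 -> A `<=` unit_sphere W -> A #<= `I_4.
Proof.
move=> /subspace_of_dim1E[f f0 ->] /subspace_of_dim1E[g g0 ->] AL AS.
have line (e : W) (a : R) : e != 0 -> `|a *: e| = 1 ->
    a *: e = `|e|^-1 *: e \/ a *: e = - (`|e|^-1 *: e).
  move=> e0; rewrite normrZ => h.
  have ne : `|e| != 0 by rewrite normr_eq0.
  have na : `|a| = `|e|^-1 by rewrite -[LHS]mulr1 -(mulfV ne) mulrA h mul1r.
  rewrite -na -scaleNr; case: (ger0P a) => _; first by left.
  by right; rewrite opprK.
(* Each line meets the sphere in two opposite points; the list of four may have repetitions, which
   only lowers the cardinal. *)
pose F (n : nat) : W := nth 0 [:: `|f|^-1 *: f; - (`|f|^-1 *: f);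
  `|g|^-1 *: g; - (`|g|^-1 *: g)] n.
apply: card_le_trans (card_image_le F `I_4); apply: subset_card_le => v Av.
have := AS _ Av; rewrite /unit_sphere/= => nv.
case: (AL _ Av) => -[a vE]; rewrite vE in nv *.
  case: (line _ _ f0 nv) => ->; first by exists 0%N.
  by exists 1%N.
case: (line _ _ g0 nv) => ->; first by exists 2%N.
by exists 3%N.
Qed.

(** * Test functionals: density, limiting signs and separation *)

Section TestFunctionals.
Context {R : realType}.
Implicit Types (x h : nat -> R) (n : nat).

(** The last component is padding: it gives each combination infinitely many codes. A number that is
    no code stands for the zero combination. *)
Definition decode n : nat * nat * nat * rat * rat * rat * nat :=
  odflt (0%N, 0%N, 0%N, 0, 0, 0, 0%N) (unpickle n).

(** Truncation keeps the n-th functional supported on the coordinates up to n and the tag 3n, which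
    later isolates a single slope. *)
Definition cut n i := if (i <= n)%N then i else 0%N.

(* Read's trick: the three-term combinations alone are not linearly independent
   modulo finitely supported sequences; the coordinate 3n tags the n-th one. *)
Definition test n x : R :=
  let: (i, j, k, a, b, c, _) := decode n in
  clamp (ratr a) * x (cut n i) + clamp (ratr b) * x (cut n j)
  + clamp (ratr c) * x (cut n k) + x (3 * n)%N.

Lemma test_lin n (a : R) h x :
  test n (fun m => a * h m + x m) = a * test n h + test n x.
Proof.
by rewrite /test; case: (decode n) => -[[[[[i j] k] b] c] d] q; ring.
Qed.

Lemma testN n x : test n (fun m => - x m) = - test n x.
Proof.
by rewrite /test; case: (decode n) => -[[[[[i j] k] b] c] d] q; ring.
Qed.

Lemma test_le n x X : (forall m, `|x m| <= X) -> `|test n x| <= 4 * X.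
Proof.
move=> xX; rewrite /test; case: (decode n) => -[[[[[i j] k] a] b] c] q.
have le t m : `|clamp t * x m| <= X.
  by rewrite normrM (le_trans _ (xX m))// ler_piMl// clamp_le1.
rewrite (_ : 4 * X = X + X + X + X); last by ring.
do 3 (rewrite (le_trans (ler_normD _ _))// lerD//).
Qed.

Lemma cut_le n i : (cut n i <= n)%N.
Proof. by rewrite /cut; case: ifP. Qed.

Lemma test_tail n x : (forall m, (m <= n)%N -> x m = 0) ->
  test n x = x (3 * n)%N.
Proof.
move=> x0; rewrite /test; case: (decode n) => -[[[[[i j] k] b] c] d] q.
by rewrite !(x0 _ (cut_le _ _)) !mulr0 !add0r.
Qed.

Lemma unbounded_injective (g : nat -> nat) N : injective g ->
  exists k, (N <= g k)%N.
Proof.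
move=> gi; apply: contrapT => h.
have lt k : (g k < N)%N by rewrite ltnNge; apply/negP => le; apply: h; exists k.
have : (size (map g (iota 0 N.+1)) <= size (iota 0 N))%N.
  apply: uniq_leq_size; first by rewrite map_inj_uniq// iota_uniq.
  by move=> m /mapP[k _ ->]; rewrite mem_iota add0n lt.
by rewrite size_map !size_iota ltnn.
Qed.

Lemma rat_approx (a e : R) : 0 < e -> exists q : rat, `|ratr q - a| <= e.
Proof.
move=> e0; have [q] : exists q : rat, ratr q \in `](a - e), (a + e)[.
  by apply: rat_in_itvoo; lra.
rewrite in_itv/= => /andP[h1 h2]; exists q.
by rewrite ler_norml; apply/andP; split; lra.
Qed.

Lemma test_dense I J K (a b c e : R) N :
    `|a| <= 1 -> `|b| <= 1 -> `|c| <= 1 -> 0 < e ->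
  exists2 n, (N <= n)%N & forall x X, (forall m, `|x m| <= X) ->
    `|test n x - (a * x I + b * x J + c * x K) - x (3 * n)%N| <= 3 * e * X.
Proof.
move=> a1 b1 c1 e0.
have [qa ha] := rat_approx a _ e0; have [qb hb] := rat_approx b _ e0.
have [qc hc] := rat_approx c _ e0.
have close (q : rat) (t : R) : `|t| <= 1 -> `|ratr q - t| <= e ->
    `|clamp (ratr q) - t| <= e.
  by move=> t1 qt; rewrite -{1}(clamp_id t t1) (le_trans (clamp_lipschitz _ _)).
pose g (s : nat) := pickle (I, J, K, qa, qb, qc, s).
have gi : injective g by move=> s s' /(pcan_inj pickleK) [].
(* A code beyond I, J and K makes the truncation harmless; one beyond N is found by varying the
   padding. *)
have [s Ns] := unbounded_injective g (N + I + J + K) gi.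
exists (g s); first by apply: leq_trans Ns; rewrite -!addnA leq_addr.
move=> x X xX; rewrite /test /decode /g pickleK/= -/(g s).
rewrite /cut !ifT; try by apply: leq_trans Ns; lia.
set p1 := clamp _; set p2 := clamp _; set p3 := clamp _.
have -> : p1 * x I + p2 * x J + p3 * x K + x (3 * g s)%N
    - (a * x I + b * x J + c * x K) - x (3 * g s)%N
  = (p1 - a) * x I + (p2 - b) * x J + (p3 - c) * x K by ring.
have le (t : R) m : `|t| <= e -> `|t * x m| <= e * X.
  by move=> te; rewrite normrM ler_pM.
rewrite (_ : 3 * e * X = e * X + e * X + e * X); last by ring.
have la := le _ I (close _ _ a1 ha); have lb := le _ J (close _ _ b1 hb).
have lc := le _ K (close _ _ c1 hc).
by do 2 (rewrite (le_trans (ler_normD _ _))// lerD//).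
Qed.

Lemma test_sequence I J K (a b c : R) :
    `|a| <= 1 -> `|b| <= 1 -> `|c| <= 1 ->
  exists n : nat -> nat, (forall q, (q <= n q)%N) /\
    forall q x X, (forall m, `|x m| <= X) ->
    `|test (n q) x - (a * x I + b * x J + c * x K) - x (3 * n q)%N|
      <= 3 * X / 2 ^+ q.
Proof.
move=> a1 b1 c1.
have h q : exists n, (q <= n)%N /\ forall x X, (forall m, `|x m| <= X) ->
    `|test n x - (a * x I + b * x J + c * x K) - x (3 * n)%N|
      <= 3 * X / 2 ^+ q.
  have e0 : 0 < (2 ^+ q)^-1 :> R by rewrite invr_gt0 exprn_gt0.
  have [n qn hn] := test_dense I J K _ _ _ _ q a1 b1 c1 e0.
  by exists n; split=> // x X xX; rewrite mulrAC; exact: hn.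
have [n hn] := choice h; exists n.
by split=> q; [case: (hn q)|case: (hn q)].
Qed.

(* For large q the clamped value is exactly the sign of the approximated
   functional, because the slope 2^n of the clamping tends to infinity. *)
Lemma clamp_test_sgr (n : nat -> nat) x X (s : R) :
    (forall q, (q <= n q)%N) ->
    x m @[m --> \oo] --> (0 : R) ->
    (forall q, `|test (n q) x - s - x (3 * n q)%N| <= X / 2 ^+ q) -> s != 0 ->
  \forall q \near \oo, clamp (2 ^+ n q * test (n q) x) = Num.sg s.
Proof.
move=> nq x0 hn s0; have ns : 0 < `|s| by rewrite normr_gt0.
(* One quarter of |s| for the tag and one for the approximation error leave |test| >= |s|/2 with the
   sign of s; the third bound makes 2^(n q) |s|/2 at least 1. *)
have /cvgrPdist_le/(_ (`|s| / 4)) := x0.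
have s4 : 0 < `|s| / 4 by rewrite divr_gt0.
move=> /(_ s4) [N _ hN].
have /cvgrPdist_le/(_ _ s4) E0 := cvg_div_pow2 X.
have /cvgrPdist_le/(_ _ s4) E1 := cvg_div_pow2 (1 : R).
near=> q.
have Nq : (N <= q)%N by near: q; exists N.
have h1 : `|x (3 * n q)%N| <= `|s| / 4.
  have := hN (3 * n q)%N; rewrite /= sub0r normrN; apply.
  by apply: (leq_trans Nq); apply: (leq_trans (nq q)); rewrite leq_pmull.
have h2 : `|X / 2 ^+ q| <= `|s| / 4.
  by rewrite -normrN -sub0r; near: q.
have h3 : `|1 / 2 ^+ q| <= `|s| / 4.
  by rewrite -normrN -sub0r; near: q.
have h4 := hn q; have h5 := ler_norm (X / 2 ^+ q).
rewrite div1r ger0_norm ?invr_ge0 ?exprn_ge0// in h3.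
set t := test (n q) x in h4 *.
have P0 : 0 < 2 ^+ n q :> R by rewrite exprn_gt0.
have Q0 : 0 < 2 ^+ q :> R by rewrite exprn_gt0.
have PQ : 2 ^+ q <= 2 ^+ n q :> R by rewrite ler_weXn2l// ler1n.
have Qs : 4 <= 2 ^+ q * `|s|.
  have : (2 ^+ q)^-1 * 2 ^+ q = 1 :> R by rewrite mulVf// gt_eqF.
  nra.
have ts : `|t - s| <= `|s| / 2.
  have := ler_normD (t - s - x (3 * n q)%N) (x (3 * n q)%N).
  by rewrite subrK; lra.
have st : Num.sg t = Num.sg s.
  move: ts ns; case: (ltrgtP s 0) s0 => // h _.
    rewrite (ltr0_norm h) (ltr0_sg h) ler_norml => /andP[_ tn] _.
    by apply: ltr0_sg; lra.
  rewrite (gtr0_norm h) (gtr0_sg h) ler_norml => /andP[tn _] _.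
  by apply: gtr0_sg; lra.
rewrite clamp_sgr ?sgrM ?(gtr0_sg P0) ?mul1r//.
rewrite normrM (gtr0_norm P0).
have tl : `|s| / 2 <= `|t|.
  by have := lerB_dist s t; rewrite distrC; lra.
nra.
Unshelve. all: by end_near. Qed.

(** Cramer's rule prescribes the values 1 at x and t at y; a small multiple of the K-th coordinate
    avoids vanishing at z, and a final rescaling bounds the coefficients. *)
Lemma separating_combination (x y z : nat -> R) I J K (t : R) :
    x I * y J - x J * y I != 0 -> z K != 0 -> t = 1 \/ t = -1 ->
  exists a b c : R, [/\ `|a| <= 1, `|b| <= 1, `|c| <= 1 &
    [/\ 0 < a * x I + b * x J + c * x K,
        0 < t * (a * y I + b * y J + c * y K)
      & a * z I + b * z J + c * z K != 0]].
Proof.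
move=> d0 zK tt; set d := x I * y J - x J * y I in d0.
pose a := (y J - t * x J) / d; pose b := (t * x I - y I) / d.
have ax : a * x I + b * x J = 1 by rewrite /a /b /d; field.
have ay : a * y I + b * y J = t by rewrite /a /b /d; field.
(* With this g, the correction changes the values at x and y by at most 1/2, which preserves their
   signs. *)
pose g := (1 + `|x K| + `|y K|)^-1 / 2.
have g0' : 0 < 1 + `|x K| + `|y K| by rewrite !ltr_wpDr.
have g0 : 0 < g by rewrite divr_gt0 ?invr_gt0.
have gE : g * (1 + `|x K| + `|y K|) = 1 / 2.
  by rewrite /g mulrAC mulVf ?gt_eqF.
have [c [c0 cg cz]] : exists c, [/\ 0 <= c, c <= g
    & a * z I + b * z J + c * z K != 0].
  have [v0|v0] := eqVneq (a * z I + b * z J) 0; last first.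
    by exists 0; rewrite mul0r addr0; split=> //; exact: ltW.
  exists g; split=> //; first exact: ltW.
  by rewrite v0 add0r mulf_neq0// gt_eqF.
pose m := 1 + `|a| + `|b|.
have m0 : 0 < m by rewrite !ltr_wpDr.
have small u : `|u| <= m -> `|m^-1 * u| <= 1.
  by move=> um; rewrite normrM gtr0_norm ?invr_gt0// ler_pdivrMl// mulr1.
have na := normr_ge0 a; have nb := normr_ge0 b.
have nx := normr_ge0 (x K); have ny := normr_ge0 (y K).
exists (m^-1 * a), (m^-1 * b), (m^-1 * c).
have fac u v w : m^-1 * a * u + m^-1 * b * v + m^-1 * c * w =
  m^-1 * (a * u + b * v + c * w) by ring.
split; try apply: small; rewrite ?/m; try lra.
  by rewrite (ger0_norm c0); nra.
have cx : - (1 / 2) <= c * x K.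
  have := ler_norm (- x K); rewrite normrN; nra.
have cy : - (1 / 2) <= t * (c * y K).
  have := ler_norm (- y K); rewrite normrN; have := ler_norm (y K).
  by case: tt => ->; nra.
rewrite !fac; split.
- by rewrite mulr_gt0 ?invr_gt0// ax; lra.
- rewrite mulrCA mulr_gt0 ?invr_gt0// ay mulrDr.
  by case: tt cy => -> cy; lra.
- by rewrite mulf_neq0// invr_eq0 gt_eqF.
Qed.

End TestFunctionals.

(** * The function [Psi] on c_0, its derivative and the asymptotics of its slopes *)

Section Renorming.
Context {R : realType}.
Implicit Types (x y z h : c0 R).

(* Keeps coordinates in R rather than R^o. *)
Definition coord x : nat -> R := fun n => x n.

Lemma coord_lin (a : R) h x :
  coord (a *: h + x) = fun n => a * coord h n + coord x n.
Proof. by []. Qed.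

Lemma coordN x : coord (- x) = fun n => - coord x n.
Proof. by []. Qed.

Lemma coord_norm x n : `|coord x n| <= `|x|.
Proof. exact: c0_norm_ub. Qed.

Lemma coord_cvg x : coord x n @[n --> \oo] --> (0 : R).
Proof. exact: c0_cvg. Qed.

Lemma coord_inj x y : (forall n, coord x n = coord y n) -> x = y.
Proof. by move=> xy; apply: val_inj; apply/funext. Qed.

Lemma coord_le1 x : exists N, forall n, (N <= n)%N -> `|coord x n| <= 1.
Proof.
have /cvgrPdist_le/(_ 1 ltr01) [N _ hN] := coord_cvg x.
by exists N => n /hN; rewrite /= sub0r normrN.
Qed.

Lemma c0_unit_subproof m : (fun n => (n == m)%:R : R^o) \in @c0_pred R.
Proof.
apply/asboolP; apply: cvg_near_cst; near=> n.
have mn : (m < n)%N by near: n; exists m.+1.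
by rewrite gtn_eqF.
Unshelve. all: by end_near. Qed.

Definition c0_unit m : c0 R := C0 (c0_unit_subproof m).

Lemma coord_unit m n : coord (c0_unit m) n = (n == m)%:R.
Proof. by []. Qed.

Variable eps : R.
Hypothesis eps_gt0 : 0 < eps.

Let slope n x : R := clamp (2 ^+ n * test n (coord x)).

Let excess_term x n : R := excess (coord x n) / eps ^+ 2.
Let huber_term x n : R :=
  huber (2 ^+ n * test n (coord x)) / (8 * 2 ^+ (3 * n)).
Let excess_deriv x h n : R :=
  2 * (coord x n - clamp (coord x n)) * coord h n / eps ^+ 2.
Let huber_deriv x h n : R :=
  slope n x * test n (coord h) / (8 * 2 ^+ (2 * n)).

(* Of the factor 2 ^+ (3 * n), one 2 ^+ n compensates the scaling inside huber;
   the remaining weight 4 ^- n makes the tail of the series from index 3 n on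
   negligible against its n-th term. *)
Definition Psi x : R := gsum (excess_term x) + gsum (huber_term x).
Definition dPsi x h : R := gsum (excess_deriv x h) + gsum (huber_deriv x h).

Let e2_gt0 : 0 < eps ^+ 2. Proof. exact: exprn_gt0. Qed.

Let pow_gt0 n : 0 < 2 ^+ n :> R. Proof. exact: exprn_gt0. Qed.

Let pow2 n : 2 ^+ (2 * n) = 2 ^+ n * 2 ^+ n :> R.
Proof. by rewrite mul2n -addnn exprD. Qed.

Let pow3 n : 2 ^+ (3 * n) = 2 ^+ n * 2 ^+ n * 2 ^+ n :> R.
Proof. by rewrite -!exprD; congr (_ ^+ _); lia. Qed.

Let pow_ge1 n : 1 <= 2 ^+ n :> R.
Proof. by rewrite exprn_ege1// ler1n. Qed.

(** Coordinates tending to 0 are eventually in [-1, 1], where the excess vanishes. *)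
Let excess_term_bounded x : geom_bounded (excess_term x).
Proof.
have [N hN] := coord_le1 x; apply: (@geom_bounded_finite _ _ N) => n Nn.
by rewrite /excess_term excess_eq0 ?mul0r// hN.
Qed.

Let excess_deriv_bounded x h : geom_bounded (excess_deriv x h).
Proof.
have [N hN] := coord_le1 x; apply: (@geom_bounded_finite _ _ N) => n Nn.
by rewrite /excess_deriv clamp_id ?hN// subrr mulr0 !mul0r.
Qed.

(** The factor 8 of the weight is 4, from the bound on [test], times 2, the sum of the powers of
    1/2; hence the series is at most |x|. *)
Let huber_term_le x n : `|huber_term x n| <= `|x| / 2 / 2 ^+ n.
Proof.
rewrite /huber_term ger0_norm; last first.
  by rewrite divr_ge0 ?huber_ge0// mulr_ge0// ltW.
have := huber_le_norm (2 ^+ n * test n (coord x)).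
rewrite normrM (gtr0_norm (pow_gt0 n)) => h1.
have h2 := test_le n (coord x) `|x| (coord_norm x).
rewrite ler_pdivrMr ?mulr_gt0// (le_trans h1)// pow3.
have -> : `|x| / 2 / 2 ^+ n * (8 * (2 ^+ n * 2 ^+ n * 2 ^+ n)) =
  2 ^+ n * (4 * `|x| * 2 ^+ n) by field; rewrite gt_eqF.
rewrite ler_pM2l// (le_trans h2)// ler_peMr// mulr_ge0//.
Qed.

Let huber_term_bounded x : geom_bounded (huber_term x).
Proof. by exists (`|x| / 2) => n; exact: huber_term_le. Qed.

Let huber_deriv_bounded x h : geom_bounded (huber_deriv x h).
Proof.
exists (`|h| / 2) => n; rewrite /huber_deriv !normrM normfV.
have h1 := clamp_le1 (2 ^+ n * test n (coord x)).
have h2 := test_le n (coord h) `|h| (coord_norm h).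
rewrite (gtr0_norm (mulr_gt0 _ _))// ler_pdivrMr ?mulr_gt0// pow2.
have -> : `|h| / 2 / 2 ^+ n * (8 * (2 ^+ n * 2 ^+ n)) =
  4 * `|h| * 2 ^+ n by field; rewrite gt_eqF.
apply: (@le_trans _ _ (1 * (4 * `|h|))); first by rewrite ler_pM.
by rewrite mul1r ler_peMr// mulr_ge0.
Qed.

Lemma dPsi_lin x (a : R) h k : dPsi x (a *: h + k) = a * dPsi x h + dPsi x k.
Proof.
rewrite /dPsi mulrDr addrACA -!gsumZ//.
rewrite -(gsumD _ (excess_deriv x k))//; last exact: geom_boundedZ.
rewrite -(gsumD _ (huber_deriv x k))//; last exact: geom_boundedZ.
congr (gsum _ + gsum _); apply/funext => n.
  by rewrite /excess_deriv coord_lin; field; rewrite gt_eqF.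
by rewrite /huber_deriv coord_lin test_lin; field; rewrite gt_eqF.
Qed.

Let huber_term_grad x h n :
  0 <= huber_term (x + h) n - huber_term x n - huber_deriv x h n
    <= (test n (coord h)) ^+ 2 / 16 / 2 ^+ n.
Proof.
have := huber_grad (2 ^+ n * test n (coord x))
  (2 ^+ n * test n (coord (x + h))).
have dE : test n (coord (x + h)) - test n (coord x) = test n (coord h).
  by rewrite -{1}[x]scale1r coord_lin test_lin mul1r addrC addKr.
rewrite -mulrBr dE -/(slope n x) => hg.
have p8 : 0 < 8 * 2 ^+ (3 * n) :> R by rewrite mulr_gt0.
rewrite /huber_term /huber_deriv.
set u := huber _; set v := huber _.
have -> : u / (8 * 2 ^+ (3 * n)) - v / (8 * 2 ^+ (3 * n)) -
    slope n x * test n (coord h) / (8 * 2 ^+ (2 * n)) =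
  (u - v - slope n x * (2 ^+ n * test n (coord h))) / (8 * 2 ^+ (3 * n)).
  by rewrite pow3 pow2; field; rewrite gt_eqF.
case/andP: hg => hl hr; apply/andP; split.
  exact: divr_ge0 hl (ltW p8).
rewrite ler_pdivrMr//; apply: (le_trans hr); rewrite le_eqVlt; apply/orP; left.
by apply/eqP; rewrite pow3; field; rewrite gt_eqF.
Qed.

Let excess_term_grad x h n :
  0 <= excess_term (x + h) n - excess_term x n - excess_deriv x h n
    <= (coord h n) ^+ 2 / eps ^+ 2.
Proof.
have := excess_grad (coord x n) (coord (x + h) n).
have -> : coord (x + h) n - coord x n = coord h n.
  by rewrite -{1}[x]scale1r coord_lin mul1r addrC addKr.
move=> hg; rewrite /excess_term /excess_deriv -!mulrBl.
case/andP: hg => hl hr; apply/andP; split.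
  exact: divr_ge0 hl (ltW e2_gt0).
by rewrite ler_pM2r// invr_gt0.
Qed.

Lemma Psi_grad x y : Psi x + dPsi x (y - x) <= Psi y.
Proof.
have yE : x + (y - x) = y by rewrite addrC subrK.
rewrite /Psi /dPsi addrACA; apply: lerD; rewrite -gsumD//; apply: gsum_le => //;
    try exact: geom_boundedD; move=> n.
  by have := excess_term_grad x (y - x) n; rewrite yE; lra.
by have := huber_term_grad x (y - x) n; rewrite yE; lra.
Qed.

Let coordZ (t : R) h n : coord (t *: h) n = t * coord h n.
Proof. by []. Qed.

Let testZ (t : R) h n : test n (coord (t *: h)) = t * test n (coord h).
Proof.
have t0 : test n (coord 0) = 0.
  have := test_lin n 1 (coord 0) (coord 0).
  by rewrite -coord_lin scale1r addr0; lra.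
by rewrite -[t *: h]addr0 coord_lin test_lin t0 addr0.
Qed.

(** The Huber remainders are summable thanks to their weights. The squares of the coordinates of h
    need not be, but beyond N both x and x + t h have coordinates in [-1, 1], so only finitely many
    excess terms contribute. *)
Lemma Psi_upper x h : exists C, forall t, 0 <= t <= 1 ->
  Psi (x + t *: h) <= Psi x + t * dPsi x h + C * t ^+ 2.
Proof.
have [N hN] : exists N, forall n, (N <= n)%N ->
    `|coord x n| + `|coord h n| <= 1.
  have half : 0 < 2^-1 :> R by rewrite invr_gt0.
  have /cvgrPdist_le/(_ _ half) [N _ hN] := coord_cvg x.
  have /cvgrPdist_le/(_ _ half) [N' _ hN'] := coord_cvg h.
  exists (maxn N N') => n; rewrite geq_max => /andP[/hN + /hN'].
  by rewrite /= !sub0r !normrN; lra.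
pose E n := if (n < N)%N then coord h n ^+ 2 / eps ^+ 2 else 0.
pose F n := (test n (coord h)) ^+ 2 / 16 / 2 ^+ n.
have bE : geom_bounded E.
  by apply: (@geom_bounded_finite _ _ N) => n Nn; rewrite /E ltnNge Nn.
have bF : geom_bounded F.
  exists (`|h| ^+ 2) => n; rewrite /F ger0_norm; last first.
    by rewrite !divr_ge0 ?sqr_ge0// ltW.
  rewrite ler_pM2r ?invr_gt0// ler_pdivrMr//.
  have := test_le n (coord h) `|h| (coord_norm h).
  by rewrite ler_norml => /andP[]; have := normr_ge0 h; nra.
exists (gsum E + gsum F) => t /andP[t0 t1].
have -> : Psi x + t * dPsi x h + (gsum E + gsum F) * t ^+ 2 =
   (gsum (excess_term x) + t * gsum (excess_deriv x h) + t ^+ 2 * gsum E) +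
   (gsum (huber_term x) + t * gsum (huber_deriv x h) + t ^+ 2 * gsum F).
  by rewrite /Psi /dPsi; ring.
apply: lerD; rewrite -!gsumZ// -!gsumD//;
  try (do ?apply: geom_boundedD => //; exact: geom_boundedZ);
  apply: gsum_le => //;
  try (do ?apply: geom_boundedD => //; exact: geom_boundedZ); move=> n.
- rewrite /E; case: ltnP => [nN|Nn].
    have := excess_term_grad x (t *: h) n.
    rewrite /excess_deriv coordZ => /andP[_].
    set u := _ (x + _) _; set v := _ x _; set a := _ - clamp _.
    rewrite exprMn => hh.
    have -> : t * (2 * a * coord h n / eps ^+ 2) =
      2 * a * (t * coord h n) / eps ^+ 2 by ring.
    by rewrite mulrA; lra.
  have h1 := hN _ Nn; have x0 := normr_ge0 (coord x n).
  have h0 := normr_ge0 (coord h n).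
  have xt : coord (x + t *: h) n = coord x n + t * coord h n by [].
  have e1 : excess_term (x + t *: h) n = 0.
    rewrite /excess_term excess_eq0 ?mul0r// xt (le_trans (ler_normD _ _))//.
    by rewrite normrM (ger0_norm t0); nra.
  have e2 : excess_term x n = 0.
    by rewrite /excess_term excess_eq0 ?mul0r//; lra.
  have e3 : excess_deriv x h n = 0.
    by rewrite /excess_deriv clamp_id ?subrr ?mulr0 ?mul0r//; lra.
  by rewrite e1 e2 e3 !mulr0 !addr0.
- have := huber_term_grad x (t *: h) n.
  rewrite /huber_deriv testZ /F exprMn => /andP[_].
  set u := _ (x + _) _; set v := _ x _ => hh.
  have -> : t * (slope n x * test n (coord h) / (8 * 2 ^+ (2 * n))) =
    slope n x * (t * test n (coord h)) / (8 * 2 ^+ (2 * n)) by ring.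
  by rewrite !mulrA in hh *; lra.
Qed.

Lemma PsiN x : Psi (- x) = Psi x.
Proof.
rewrite /Psi; congr (gsum _ + gsum _); apply/funext => n.
  by rewrite /excess_term coordN excessN.
by rewrite /huber_term coordN testN mulrN huberN.
Qed.

Lemma Psi_unit_ball x : `|x| <= 1 -> Psi x <= 1.
Proof.
move=> x1; rewrite /Psi.
have -> : gsum (excess_term x) = 0.
  rewrite (@gsum_single _ _ 0) => [|n _];
  by rewrite /excess_term excess_eq0 ?mul0r// (le_trans (coord_norm _ _)).
rewrite add0r (le_trans (ler_norm _))//.
by rewrite (le_trans (gsum_abs_le _ _ (huber_term_le x)))//; lra.
Qed.

Lemma Psi0 : Psi 0 = 0.
Proof.
rewrite /Psi.
have -> : gsum (excess_term 0) = 0.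
  rewrite (@gsum_single _ _ 0) => [|n _];
  by rewrite /excess_term excess_eq0 ?mul0r// normr0.
apply/eqP; rewrite add0r -normr_le0.
by rewrite (le_trans (gsum_abs_le _ _ (huber_term_le 0)))// normr0; lra.
Qed.

(** All terms being nonnegative, each excess is at most eps^2; this is what the division by eps^2 in
    [excess_term] is for. *)
Lemma Psi_bounded x : Psi x <= 1 -> `|x| <= 1 + eps.
Proof.
move=> Px; apply: c0_norm_le => m; rewrite -/(coord x m).
apply: norm_le_excess => //.
have ex0 n : 0 <= excess_term x n by rewrite divr_ge0 ?excess_ge0// ltW.
have h0 : 0 <= gsum (huber_term x).
  apply: gsum_ge0 => // n.
  by rewrite divr_ge0 ?huber_ge0// mulr_ge0// ltW.
pose u n := if n == m then excess_term x n else 0.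
have : gsum u <= gsum (excess_term x).
  apply: gsum_le => //.
    apply: (@geom_bounded_finite _ _ m.+1) => n mn.
    by rewrite /u gtn_eqF.
  by move=> n; rewrite /u; case: eqP.
rewrite (@gsum_single _ _ m); last first.
  by move=> n /negbTE nm; rewrite /u nm.
rewrite /u eqxx => h1; rewrite -[eps ^+ 2]mul1r -ler_pdivrMr//.
by move: Px; rewrite /Psi /excess_term in h1 *; lra.
Qed.

(* Evaluating at the tagging coordinate 3n isolates the n-th slope up to a tail
   that decays faster than its weight. *)
Lemma slope_relation x y z (A B C : R) :
    (forall h, A * dPsi x h + B * dPsi y h = C * dPsi z h) ->
  exists Q N, forall n, (N <= n)%N ->
    `|A * slope n x + B * slope n y - C * slope n z| <= Q / 2 ^+ n.
Proof.
move=> rel; have [Nx hx] := coord_le1 x; have [Ny hy] := coord_le1 y.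
have [Nz hz] := coord_le1 z.
(* Beyond this threshold coordinate 3n of x, y and z lies in [-1, 1]; the successor ensures n <
   3n. *)
exists (8 * (`|A| + `|B| + `|C|)), (Nx + Ny + Nz).+1 => n Nn.
set Q := `|A| + `|B| + `|C|.
pose beta l := A * slope l x + B * slope l y - C * slope l z.
have beta_le l : `|beta l| <= Q.
  have le (a : R) w : `|a * slope l w| <= `|a|.
    by rewrite normrM ler_piMr// clamp_le1.
  rewrite /beta /Q (le_trans (ler_normD _ _))// normrN lerD//.
  by rewrite (le_trans (ler_normD _ _))// lerD.
pose e := c0_unit (3 * n).
have ex0 w Nw : (forall m, (Nw <= m)%N -> `|coord w m| <= 1) ->
    (Nw <= 3 * n)%N -> gsum (excess_deriv w e) = 0.
  move=> hw Nwn.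
  have z0 m : excess_deriv w e m = 0.
    rewrite /excess_deriv coord_unit; case: eqP => [->|_].
      by rewrite clamp_id ?hw// subrr mulr0 !mul0r.
    by rewrite mulr0 mul0r.
  by rewrite (@gsum_single _ _ 0).
have := rel e; rewrite /dPsi.
rewrite (ex0 x Nx)//; last by lia.
rewrite (ex0 y Ny)//; last by lia.
rewrite (ex0 z Nz)//; last by lia.
rewrite !add0r => /eqP; rewrite -subr_eq0 => /eqP.
rewrite -!gsumZ// -gsumD//; try exact: geom_boundedZ.
rewrite -gsumB; try (do ?apply: geom_boundedD => //; exact: geom_boundedZ).
pose u l := beta l * (test l (coord e) / (8 * 2 ^+ (2 * l))).
rewrite (_ : (fun l => _) = u); last first.
  by apply/funext => l; rewrite /u /beta /huber_deriv; ring.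
pose s l := if l == n then u n else 0.
pose r l := if l == n then 0 else u l.
have rle l : `|r l| <= Q / (2 * (2 ^+ (2 * n) * 2 ^+ n)) / 2 ^+ l.
  have Q0 : 0 <= Q by rewrite /Q !addr_ge0.
  have rhs0 : 0 <= Q / (2 * (2 ^+ (2 * n) * 2 ^+ n)) / 2 ^+ l.
    by rewrite !divr_ge0// ?mulr_ge0// ltW.
  rewrite /r; case: eqP => [_|/eqP ln]; first by rewrite normr0.
  (* For l < 3n the functional sees coordinate 3n only through its tag, so only if l = n. For l >=
     3n the weight satisfies 4^-l <= 2^-(3n) 2^-l. *)
  have [l3|l3] := ltnP l (3 * n).
    rewrite /u test_tail ?coord_unit.
      by rewrite eqn_pmul2l// (negbTE ln) mul0r mulr0 normr0.
    by move=> m ml; rewrite coord_unit ltn_eqF// (leq_ltn_trans ml).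
  rewrite /u normrM.
  have te : `|test l (coord e)| <= 4 * 1.
    apply: test_le => m; rewrite coord_unit.
    by case: eqP => _; rewrite ?normr0 ?normr1.
  have tb : `|test l (coord e) / (8 * 2 ^+ (2 * l))| <= (2 * 2 ^+ (2 * l))^-1.
    rewrite normrM normfV (gtr0_norm (mulr_gt0 _ _))// ler_pdivrMr ?mulr_gt0//.
    by rewrite (le_trans te)// le_eqVlt; apply/orP; left; apply/eqP; field;
      rewrite gt_eqF.
  apply: (le_trans (ler_pM _ _ (beta_le l) tb)) => //.
  rewrite -mulrA ler_wpM2l// -invfM lef_pV2 ?posrE ?mulr_gt0//.
  rewrite -mulrA ler_pM2l// (pow2 l) ler_pM2r// -exprD.
  by rewrite ler_weXn2l ?ler1n//; lia.
have br : geom_bounded r by exists (Q / (2 * (2 ^+ (2 * n) * 2 ^+ n))).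
have bs : geom_bounded s.
  by apply: (@geom_bounded_finite _ _ n.+1) => l nl; rewrite /s gtn_eqF.
have -> : u = (fun l => s l + r l).
  apply/funext => l; rewrite /s /r; case: eqP => [->|_].
    by rewrite addr0.
  by rewrite add0r.
rewrite gsumD// (@gsum_single _ s n); last first.
  by move=> l /negbTE ln; rewrite /s ln.
rewrite /s eqxx => /eqP; rewrite addr_eq0 => /eqP un.
(* The n-th term, of weight 1/(8 4^n), balances a tail of size at most (|A| + |B| + |C|) / 8^n. *)
have := gsum_abs_le _ _ rle; rewrite -normrN -un /u test_tail; last first.
  by move=> m mn; rewrite coord_unit ltn_eqF//; lia.
rewrite coord_unit eqxx mul1r normrM normfV (gtr0_norm (mulr_gt0 _ _))//.
rewrite ler_pdivrMr ?mulr_gt0// => hb; rewrite -/(beta n) (le_trans hb)//.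
rewrite le_eqVlt; apply/orP; left; apply/eqP; field.
by rewrite !gt_eqF.
Qed.

Lemma derivative_combination x y z (A B C : R) :
    (forall h, A * dPsi x h + B * dPsi y h = C * dPsi z h) ->
    z != 0 -> (exists I J, coord x I * coord y J != coord x J * coord y I) ->
  A = 0 \/ B = 0.
Proof.
move=> rel z0 [I [J]]; rewrite -subr_eq0 => d0.
have [K zK] : exists K, coord z K != 0.
  apply: contrapT => h; move/eqP: z0; apply; apply: coord_inj => n.
  by apply: contrapT => /eqP zn; apply: h; exists n.
have [Q [N slopes]] := slope_relation _ _ _ _ _ _ rel.
have key t : t = 1 \/ t = -1 -> `|A + t * B| = `|C|.
  move=> tt.
  (* Choose a functional positive at x, of sign t at y and nonzero at z. *)
  have [a [b [c [a1 b1 c1 [sx sy sz]]]]] :=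
    separating_combination _ (coord y) (coord z) _ _ _ t d0 zK tt.
  have [n [nq hn]] := test_sequence I J K _ _ _ a1 b1 c1.
  set s := fun w => a * coord w I + b * coord w J + c * coord w K.
  have sgr w : s w != 0 ->
      \forall q \near \oo, slope (n q) w = Num.sg (s w).
    move=> sw; apply: (clamp_test_sgr n (coord w) (3 * `|w|)) => //.
      exact: coord_cvg.
    by move=> q; apply: hn; exact: coord_norm.
  have Ex := sgr x (lt0r_neq0 sx).
  have sy0 : s y != 0 by apply/eqP => h; rewrite -/(s y) h mulr0 ltxx in sy.
  have Ey := sgr y sy0.
  have Ez := sgr z sz.
  have sgy : Num.sg (s y) = t.
    case: tt sy => ->; rewrite -/(s y) ?mul1r ?mulN1r ?oppr_gt0 => sy.
      exact: gtr0_sg.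
    exact: ltr0_sg.
  pose v := A * Num.sg (s x) + B * Num.sg (s y) - C * Num.sg (s z).
  (* Along [n q] the slopes are eventually equal to the signs, so v is smaller than every d > 0. *)
  have v0 : v = 0.
    apply/eqP; rewrite -normr_le0; apply/ler_addgt0Pr => d dd; rewrite add0r.
    have /cvgrPdist_le/(_ _ dd) [N' _ hN'] := cvg_div_pow2 Q.
    near \oo => q.
    have -> : v = A * slope (n q) x + B * slope (n q) y - C * slope (n q) z.
      rewrite /v; congr (_ * _ + _ * _ - _ * _); apply/esym;
        by near: q.
    apply: (le_trans (slopes (n q) _)).
      by apply: leq_trans (nq q); near: q; exists N.
    have := hN' (n q); rewrite /= sub0r normrN => h.
    apply: (le_trans (ler_norm _)); apply: h.
    by apply: leq_trans (nq q); near: q; exists N'.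
  have <- : A * Num.sg (s x) + B * Num.sg (s y) = A + t * B.
    by rewrite sgy (gtr0_sg sx); ring.
  have -> : A * Num.sg (s x) + B * Num.sg (s y) = C * Num.sg (s z).
    by apply/eqP; rewrite -subr_eq0; apply/eqP.
  by rewrite normrM normr_sg sz mulr1.
have k1 := key 1 (or_introl erefl); have k2 := key (-1) (or_intror erefl).
have /eqP : A * B = 0.
  have : (A + 1 * B) ^+ 2 = (A + -1 * B) ^+ 2.
    by rewrite -real_normK ?num_real// k1 -k2 real_normK ?num_real.
  by lra.
by rewrite mulf_eq0 => /orP[] /eqP; [left|right].
Unshelve. all: by end_near. Qed.

End Renorming.

(** * Norm-attaining functionals of the renormed space *)

Section Attainment.
Context {R : realType} (eps : R) (eps_gt0 : 0 < eps).

Let eps1_gt0 : 0 < 1 + eps. Proof. by rewrite addr_gt0. Qed.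

Definition smooth_norm : norm_on (c0 R) :=
  gauge_norm_on (Psi eps) (dPsi eps) (1 + eps) (dPsi_lin eps eps_gt0)
    (Psi_grad eps eps_gt0) (PsiN eps) (Psi_unit_ball eps eps_gt0) eps1_gt0
    (Psi_bounded eps eps_gt0).

Let p := smooth_norm.
Let X : normedModType R := renormed p.

Lemma smooth_norm_equivalent : eps_equivalent eps p.
Proof.
(* The set {Psi <= 1} lies between the supremum balls of radii 1 and 1 + eps. *)
exists 1, (1 + eps)^-1; split; rewrite ?invr_gt0// ?invrK ?mul1r// => x.
rewrite mul1r; apply/andP; split.
  exact: (norm_le_gauge (Psi eps) (1 + eps) (Psi_unit_ball eps eps_gt0) eps1_gt0
    (Psi_bounded eps eps_gt0)).
exact: (gauge_le_norm (Psi eps) (Psi_unit_ball eps eps_gt0)).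
Qed.

Let attained_proportional (f : dual X) (x : X) :
  p x = 1 -> `|f x| = `|f| -> exists mu : R, forall h, f h = mu * dPsi eps x h.
Proof.
move=> px fx.
(* The multiplier rule is for functionals maximal at x, so it is applied to f or to -f according to
   the sign of f x. *)
have sup (g : X -> R) : (forall a h k, g (a *: h + k) = a * g h + g k) ->
    (forall u, `|g u| = `|f u|) -> 0 <= g x ->
    exists mu, forall h, g h = mu * dPsi eps x h.
  move=> glin gf gx0.
  apply: (support_proportional (Psi eps) (dPsi eps) (dPsi_lin eps eps_gt0)
    (Psi_grad eps eps_gt0) (Psi_upper eps eps_gt0) (Psi0 eps eps_gt0)
    (Psi_unit_ball eps eps_gt0) g x) => //.
  move=> u pu; rewrite (le_trans (ler_norm _))// -(ger0_norm gx0) !gf fx.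
  exact: (@dual_norm_ub _ _ f).
have flin a h k : f (a *: h + k) = a * f h + f k by exact: dual_linear.
have [fx0|fx0] := lerP 0 (f x); first exact: sup.
have [mu hmu] : exists mu, forall h, - f h = mu * dPsi eps x h.
  apply: (sup (fun h => - f h)) => [a h k|u|].
  - by rewrite flin opprD mulrN.
  - exact: normrN.
  - by rewrite oppr_ge0 ltW.
by exists (- mu) => h; rewrite mulNr -hmu opprK.
Qed.

Lemma NA_no_combination (f g : dual X) (a b : R) :
    NA X f -> NA X g -> lin_indep [tuple f; g] -> NA X (a *: f + b *: g) ->
  a = 0 \/ b = 0.
Proof.
move=> [x px fx] [y py gy] /lin_indep2P fg [z pz hz].
have [mu fE] := attained_proportional _ _ px fx.
have [nu gE] := attained_proportional _ _ py gy.
have [xi hE] := attained_proportional _ _ pz hz.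
have mu0 : mu != 0.
  apply/eqP => mu0; have [] := fg 1 0; last by move/eqP; rewrite oner_eq0.
  rewrite scale0r addr0 scale1r; apply: val_inj; apply/funext => h.
  by rewrite /= fE mu0 mul0r.
have nu0 : nu != 0.
  apply/eqP => nu0; have [] := fg 0 1; last by move=> _ /eqP; rewrite oner_eq0.
  rewrite scale0r add0r scale1r; apply: val_inj; apply/funext => h.
  by rewrite /= gE nu0 mul0r.
have nz (w : c0 R) : p w = 1 -> w != 0.
  move=> pw; apply/eqP => w0; move: pw; rewrite w0.
  have -> : p 0 = 0 by rewrite -(scale0r 0) norm_onZ normr0 mul0r.
  by move/eqP; rewrite eq_sym oner_eq0.
have [par|npar] := pselect (exists I J,
    coord x I * coord y J != coord x J * coord y I).
  have rel h : (a * mu) * dPsi eps x h + (b * nu) * dPsi eps y h =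
      xi * dPsi eps z h.
    by rewrite -hE -!mulrA -fE -gE.
  have [/eqP|/eqP] :=
    derivative_combination _ eps_gt0 _ _ _ _ _ _ rel (nz z pz) par.
    by rewrite mulf_eq0 (negbTE mu0) orbF => /eqP; left.
  by rewrite mulf_eq0 (negbTE nu0) orbF => /eqP; right.
(* Now y is a multiple of x by a scalar of modulus 1, so g attains its norm at x too, and f, g are
   multiples of the same derivative. *)
exfalso.
have [I xI] : exists I, coord x I != 0.
  apply: contrapT => h; move/eqP: (nz x px); apply; apply: coord_inj => n.
  by apply: contrapT => /eqP zn; apply: h; exists n.
pose c := coord y I / coord x I.
have yE : y = c *: x :> c0 R.
  apply: coord_inj => n; rewrite -[c *: x]addr0 coord_lin.
  have : coord x I * coord y n = coord x n * coord y I.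
    by apply: contrapT => /eqP h; apply: npar; exists I, n.
  move=> h; rewrite [coord 0 n](_ : _ = 0)// addr0.
  by apply: (mulfI xI); rewrite h /c; field.
have c1 : `|c| = 1.
  have : p y = 1 := py.
  by rewrite yE norm_onZ (_ : p x = 1)// mulr1.
have gx : `|g x| = `|g|.
  rewrite -gy; have -> : g y = c * g x by rewrite yE; exact: linearZ.
  by rewrite normrM c1 mul1r.
have [nu' gE'] := attained_proportional _ _ px gx.
have [] := fg nu' (- mu).
  apply: val_inj; apply/funext => h.
  rewrite -[LHS]/(nu' * f h + - mu * g h) fE gE'.
  by rewrite -[RHS]/(0 : R); ring.
by move=> _ /eqP; rewrite oppr_eq0 (negbTE mu0).
Qed.

End Attainment.

Theorem mainTheorem2 (R : realType) (eps : R) (eps_gt0 : 0 < eps) :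
  exists p : norm_on (c0 R), eps_equivalent eps p /\
  let X := renormed p in
  [/\ forall Z : set (dual X), subspace_of_dim 2 Z ->
        exists L1 L2 : set (dual X),
          [/\ subspace_of_dim 1 L1, subspace_of_dim 1 L2
            & Z `&` NA X `<=` L1 `|` L2],
      forall Z : set (dual X), subspace_of_dim 2 Z ->
        (Z `&` unit_sphere (dual X) `&` NA X) #<= `I_4
    & forall f g : dual X, NA X f -> NA X g -> lin_indep [tuple f; g] ->
        forall t : R, 0 < t < 1 -> ~ NA X (t *: f + (1 - t) *: g)].
Proof.
exists (smooth_norm eps eps_gt0); split; first exact: smooth_norm_equivalent.
move=> X.
have lines (Z : set (dual X)) : subspace_of_dim 2 Z ->
    exists L1 L2, [/\ subspace_of_dim 1 L1, subspace_of_dim 1 L2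
      & Z `&` NA X `<=` L1 `|` L2].
  apply: two_lines => f g fNA gNA fg a b.
  exact: NA_no_combination.
split=> // [Z /lines[L1 [L2 [h1 h2 h]]]|f g fNA gNA fg t /andP[t0 t1] tNA].
  apply: (card_sphere_two_lines _ L1 L2) => // v [[Zv Sv] Nv] //.
  exact: h.
have [] := NA_no_combination _ _ _ _ _ _ fNA gNA fg tNA; lra.
Qed.
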